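(* Let $d\geq 1$ and let $\{B(x_{i},r_{i})\}_{i=1}^{\infty}$ be a sequence of closed Euclidean balls in $\mathbb{R}^{d}$, with centres $x_i\in\mathbb{R}^d$ and radii $r_i>0$. Assume that $\{B(x_{i},r_{i})\}_{i=1}^{\infty}$ is shrinking locally. Then Lebesgue almost every $\alpha\in\mathbb{R}^{d}$ belongs to $\limsup B(x_{i},r_{i})$ if and only if for all $\kappa>0$, Lebesgue almost every $\alpha\in\mathbb{R}^{d}$ belongs to $\limsup B(x_{i},\kappa r_{i})$.
   Context: $B(x,r)$ denotes the closed $d$-dimensional Euclidean ball centred at $x\in\mathbb{R}^{d}$ with radius $r>0$. A countable family of balls $\{B(x_{i},r_{i})\}_{i=1}^{\infty}$ is understood as a family indexed by $i\in\mathbb{N}$ (repetitions allowed, and elements are counted by index). The lim-sup set is $$\limsup B(x_{i},r_{i})=\bigcap_{n=1}^{\infty}\bigcup_{i=n}^{\infty}B(x_{i},r_{i}),$$ i.e. the set of $\alpha\in\mathbb{R}^{d}$ contained in $B(x_i,r_i)$ for infinitely many $i$; similarly for $\limsup B(x_i,\kappa r_i)$. The family $\{B(x_{i},r_{i})\}_{i=1}^{\infty}$ is called shrinking locally if for every ball $B(y,r)$ ($y\in\mathbb{R}^d$, $r>0$) and every $\epsilon>0$, there are only finitely many indices $i$ such that $B(x_{i},r_{i})\cap B(y,r)\neq\emptyset$ and $r_{i}>\epsilon$. *)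

(* Defs.v *)
From HB Require Import structures.
From mathcomp Require Import all_boot all_order all_algebra.
From mathcomp Require Import all_classical all_reals all_analysis.

Set Implicit Arguments.
Unset Strict Implicit.
Unset Printing Implicit Defensive.

Import Order.TTheory GRing.Theory Num.Theory.
Import numFieldNormedType.Exports.

Local Open Scope classical_set_scope.
Local Open Scope ring_scope.

(* Points of R^d are tuples rather than row vectors because tuples carry the
   product (Borel) sigma-algebra. *)
Notation euclidean R d := (d.-tuple (measurableTypeR R)).

Section lebesgue_measure_cons.
Local Open Scope ereal_scope.
Context (R : realType) (d : nat).

Definition cons_pair (p : measurableTypeR R * euclidean R d) :
  euclidean R d.+1 := [tuple of p.1 :: p.2].

Lemma measurable_cons_pair : measurable_fun setT cons_pair.
Proof. exact: measurable_cons. Qed.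

Lemma measurable_thead_behead : measurable_fun setT
  (fun t : euclidean R d.+1 => (thead t, [tuple of behead t] : euclidean R d)).
Proof.
apply/measurable_fun_pair; first exact: measurable_tnth.
exact: measurable_behead.
Qed.

Variable mu : {sigma_finite_measure set (euclidean R d) -> \bar R}.

Definition lebesgue_measure_cons : set (euclidean R d.+1) -> \bar R :=
  pushforward (lebesgue_measure \x mu) cons_pair.

Let cons0 : lebesgue_measure_cons set0 = 0.
Proof. by rewrite /lebesgue_measure_cons /pushforward preimage_set0 measure0. Qed.

Let cons_ge0 A : 0 <= lebesgue_measure_cons A.
Proof. by rewrite /lebesgue_measure_cons /pushforward measure_ge0. Qed.

Let cons_sigma_additive : semi_sigma_additive lebesgue_measure_cons.
Proof.
move=> F mF tF mUF; rewrite /lebesgue_measure_cons /pushforward preimage_bigcup.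
apply: measure_semi_sigma_additive.
- by move=> n; rewrite -[X in measurable X]setTI; exact: measurable_cons_pair.
- apply/trivIsetP => /= i j _ _ ij; rewrite -preimage_setI.
  by move/trivIsetP : tF => /(_ _ _ _ _ ij) ->//; rewrite preimage_set0.
- rewrite -preimage_bigcup -[X in measurable X]setTI.
  exact: measurable_cons_pair.
Qed.

HB.instance Definition _ := isMeasure.Build _ _ _ lebesgue_measure_cons
  cons0 cons_ge0 cons_sigma_additive.

Let cons_sigma_finite : sigma_finite setT lebesgue_measure_cons.
Proof.
have /sigma_finiteP[F [FT ndF Foo]] := sigma_finiteT (@lebesgue_measure R).
have /sigma_finiteP[G [GT ndG Goo]] := sigma_finiteT mu.
pose u (t : euclidean R d.+1) : measurableTypeR R * euclidean R d :=
  (thead t, [tuple of behead t]).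
have uK : cancel cons_pair u.
  by case=> x t; rewrite /u /cons_pair theadE; congr pair; exact: val_inj.
exists (fun n => u @^-1` (F n `*` G n)).
  apply/esym; rewrite -subTset => t _.
  have [m _ Fm] : (\bigcup_n F n) (u t).1 by rewrite -FT.
  have [n _ Gn] : (\bigcup_n G n) (u t).2 by rewrite -GT.
  exists (maxn m n) => //; split.
    by move: Fm; exact/subsetPset/ndF/leq_maxl.
  by move: Gn; exact/subsetPset/ndG/leq_maxr.
move=> k; have [mF Fk] := Foo k; have [mG Gk] := Goo k; split.
  rewrite -[X in measurable X]setTI; apply: measurable_thead_behead => //.
  exact: measurableX.
rewrite /lebesgue_measure_cons /pushforward -comp_preimage.
rewrite (_ : u \o cons_pair = id); last by apply/funext => p /=; rewrite uK.
by rewrite preimage_id product_measure1E// lte_mul_pinfty// ge0_fin_numE.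
Qed.

HB.instance Definition _ := Measure_isSigmaFinite.Build _ _ _
  lebesgue_measure_cons cons_sigma_finite.

End lebesgue_measure_cons.

(* The d-fold product of the one-dimensional Lebesgue measure, on Borel sets.
   No completion is needed: [.-negligible] and [{ae _, _}] range over subsets
   of Borel null sets, which are exactly the Lebesgue-null sets. *)
Fixpoint lebesgue_measure_dim (R : realType) (d : nat) :
    {sigma_finite_measure set (euclidean R d) -> \bar R} :=
  match d with
  | 0 => \d_([tuple] : euclidean R 0)
  | n.+1 => lebesgue_measure_cons (lebesgue_measure_dim R n)
  end.

Lemma lebesgue_measure_dim_box (R : realType) (d : nat)
    (A : 'I_d -> set (measurableTypeR R)) :
  (forall i, measurable (A i)) ->
  lebesgue_measure_dim R d [set t | forall i, A i (tnth t i)] =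
  (\prod_(i < d) lebesgue_measure (A i))%E.
Proof.
elim: d A => [|d IH] A mA.
  by rewrite big_ord0 /= diracE mem_set//; case.
have mbox : measurable
    [set t : euclidean R d | forall i, A (lift ord0 i) (tnth t i)].
  have -> : [set t : euclidean R d | forall i, A (lift ord0 i) (tnth t i)] =
      \bigcap_i ((@tnth d (measurableTypeR R))^~ i @^-1` A (lift ord0 i)).
    by apply/seteqP; split=> t /= h i; [move=> _|]; exact: h.
  apply: fin_bigcap_measurable => [|i _]; first exact: finite_finset.
  by rewrite -[X in measurable X]setTI; exact: measurable_tnth.
rewrite big_ord_recl /= /lebesgue_measure_cons /pushforward.
have -> : @cons_pair R d @^-1` [set t | forall i, A i (tnth t i)] =
    A ord0 `*` [set t | forall i, A (lift ord0 i) (tnth t i)].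
  apply/seteqP; split=> [[x t] /= h|[x t] /= [h0 h] i].
    split=> [|i]; first exact: (h ord0).
    by have := h (lift ord0 i); rewrite tnthS.
  by case: (unliftP ord0 i) => [j|] ->//; rewrite tnthS.
by rewrite product_measure1E// (IH (fun i => A (lift ord0 i))).
Qed.

Section balls.
Context (R : realType) (d : nat).

Definition euclidean_dist (x y : euclidean R d) : R :=
  Num.sqrt (\sum_(i < d) (tnth x i - tnth y i) ^+ 2).

Definition euclidean_closed_ball (x : euclidean R d) (r : R) :
  set (euclidean R d) := [set y | euclidean_dist x y <= r].

Definition shrinking_locally (x : nat -> euclidean R d) (r : nat -> R) : Prop :=
  forall (y : euclidean R d) (s : R), 0 < s -> forall e : R, 0 < e ->
    finite_set [set i | euclidean_closed_ball (x i) (r i)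
                        `&` euclidean_closed_ball y s !=set0 /\ e < r i].

End balls.

(* Main.v *)
Require Import Defs.
From mathcomp Require Import all_boot all_order all_algebra.
From mathcomp Require Import all_classical all_reals all_analysis.
From mathcomp Require Import ring lra.

Set Implicit Arguments.
Unset Strict Implicit.
Unset Printing Implicit Defensive.

Import Order.TTheory GRing.Theory Num.Theory.
Import numFieldNormedType.Exports.

Local Open Scope classical_set_scope.
Local Open Scope ring_scope.

(** A ball of radius [k * r i] is a fixed proportion of the ball of radius
    [r i], so a measurable set [C] that misses all the small balls from some
    index on cannot be nearly full in the large ones; but almost every point
    of [C] lies in arbitrarily small large balls, hence is not a point of
    density of [C], so that [C] is null. Since the points missed by the limsup
    set of the small balls form a countable union of such sets [C], this gives
    the nontrivial implication; [k = 1] gives the other one.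

    The density argument is made quantitative by a covering. Let [Q] be
    bounded and let [U] be an open set containing [C `&` Q] that exceeds it by
    measure at most [e]. Almost every point of [C `&` Q] lies in some large
    ball contained in [U]. For any finitely many of these, Vitali selects
    disjoint ones that account, up to a constant, for the measure of their
    union. The corresponding small balls are disjoint, lie in [U] and miss [C],
    so their total measure is at most [e]. Hence the measure of [C `&` Q] is at
    most a constant times [e], for every [e].

    Every ball of radius [r] lies between the sup-norm balls (cubes) of radii
    [r / d] and [r]. As [k] is arbitrary, the factor [d] is harmless and all the
    geometry is done with cubes, whose measure is explicit. Local shrinking
    enters in [lim_sup_set_small_cubes]; outer regularity is
    [measurable_sandwiched], the covering estimate is
    [measure_bigcup_cube_le], and [negligible_avoid_cubes] combines them. *)

(** * Cubes *)

Section cubes.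
Context (R : realType) (d : nat).
Implicit Types (x y : euclidean R d) (r s : R).

Definition cube x r : set (euclidean R d) :=
  [set t | forall i, `|(tnth t i : R) - tnth x i| <= r].

Lemma subset_cube x r s : r <= s -> cube x r `<=` cube x s.
Proof. by move=> rs t xt i; exact: le_trans (xt i) rs. Qed.

Lemma cube_sym x y r : cube x r y -> cube y r x.
Proof. by move=> xy i; rewrite distrC. Qed.

Lemma cube_sub_cubeD x y r s : cube y r x -> cube x s `<=` cube y (s + r).
Proof.
move=> xy t xt i; rewrite (le_trans (ler_distD (tnth x i : R) _ _))//.
by rewrite lerD.
Qed.

Lemma cube_sub_closed_ball x r : (0 < d)%N -> 0 <= r ->
  cube x (r / d%:R) `<=` euclidean_closed_ball x r.
Proof.
move=> d0 r0 t xt; rewrite /euclidean_closed_ball /euclidean_dist /=.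
have d0' : 0 < d%:R :> R by rewrite ltr0n.
rewrite -[leRHS]ger0_norm// -sqrtr_sqr ler_sqrt ?sqr_ge0//.
apply: (@le_trans _ _ (\sum_(i < d) (r / d%:R) ^+ 2)).
  apply: ler_sum => i _; rewrite -real_normK ?num_real// lerXn2r ?nnegrE//.
    by rewrite divr_ge0// ltW.
  by rewrite distrC.
rewrite sumr_const card_ord -[leLHS]mulr_natl expr_div_n [d%:R ^+ 2]expr2 invfM.
rewrite mulrCA (mulrA d%:R) mulfV ?gt_eqF// mul1r.
by rewrite ler_piMr ?sqr_ge0// invf_le1// ler1n.
Qed.

Lemma closed_ball_sub_cube x r : euclidean_closed_ball x r `<=` cube x r.
Proof.
move=> t; rewrite /euclidean_closed_ball /euclidean_dist /= => xt i.
apply: le_trans xt; rewrite distrC -sqrtr_sqr.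
rewrite ler_sqrt; last by apply: sumr_ge0 => j _; exact: sqr_ge0.
rewrite (bigD1 i)//= lerDl.
by apply: sumr_ge0 => j _; exact: sqr_ge0.
Qed.

Let side x r i : set (measurableTypeR R) :=
  `[(tnth x i : R) - r, tnth x i + r]%classic.

Let cubeE x r : cube x r = [set t | forall i, side x r i (tnth t i)].
Proof.
by apply/seteqP; split => t /= xt i; have := xt i;
  rewrite /side /= in_itv /= ler_distl.
Qed.

Lemma measurable_box (A : 'I_d -> set (measurableTypeR R)) :
  (forall i, measurable (A i)) ->
  measurable [set t : euclidean R d | forall i, A i (tnth t i)].
Proof.
move=> mA.
have -> : [set t : euclidean R d | forall i, A i (tnth t i)] =
    \bigcap_i ((@tnth d (measurableTypeR R))^~ i @^-1` A i).
  by apply/seteqP; split=> t /= h i; [move=> _|]; exact: h.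
apply: fin_bigcap_measurable => [|i _]; first exact: finite_finset.
by rewrite -[X in measurable X]setTI; exact: measurable_tnth.
Qed.

Lemma measurable_cube x r : measurable (cube x r).
Proof.
rewrite cubeE; apply: (@measurable_box (side x r)) => i.
exact: measurable_itv.
Qed.

Lemma lebesgue_measure_cube x r : 0 <= r ->
  lebesgue_measure_dim R d (cube x r) = ((r *+ 2) ^+ d)%:E.
Proof.
move=> r0; rewrite cubeE (lebesgue_measure_dim_box (A := side x r)); last first.
  by move=> i; exact: measurable_itv.
transitivity (\prod_(i < d) (r *+ 2)%:E)%E.
  apply: eq_bigr => i _; rewrite /side lebesgue_measure_itv /= lte_fin.
  case: ltP => [_|r0']; first by rewrite -EFinB; congr EFin; ring.
  by congr EFin; lra.
by rewrite prodEFin prodr_const card_ord.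
Qed.

End cubes.

(** * Regularity of finite Borel measures *)

Section regularity.
Context (R : realType) (d : nat).
Implicit Types (A O F : set (euclidean R d)).

(** This is the Euclidean topology, as cubes and balls are comparable. *)
Definition cube_open O :=
  forall a, O a -> exists2 e : R, 0 < e & cube a e `<=` O.

Lemma cube_openT : cube_open setT.
Proof. by move=> a _; exists 1. Qed.

Lemma cube_openI O O' : cube_open O -> cube_open O' -> cube_open (O `&` O').
Proof.
move=> oO oO' a [/oO[e e0 eO] /oO'[e' e'0 eO']].
exists (Num.min e e'); first by rewrite lt_min e0.
move=> t et; split.
  by apply/eO/subset_cube/et; rewrite ge_min lexx.
by apply/eO'/subset_cube/et; rewrite ge_min lexx orbT.
Qed.

Lemma cube_open_bigcup (O : (set (euclidean R d))^nat) :
  (forall k, cube_open (O k)) -> cube_open (\bigcup_k O k).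
Proof.
move=> oO a [k _ /(oO k)[e e0 eO]]; exists e => // t /eO; exact: bigcup_sup.
Qed.

Lemma cube_open_finbigcap (O : (set (euclidean R d))^nat) m :
  (forall k, cube_open (O k)) -> cube_open (\bigcap_(k < m) O k).
Proof.
move=> oO; rewrite bigcap_mkord.
by elim/big_ind : _ => //; [exact: cube_openT|exact: cube_openI].
Qed.

Lemma cube_open_gt (i : 'I_d) (c : R) :
  cube_open [set t : euclidean R d | c < tnth t i].
Proof.
move=> a /= ca; exists (((tnth a i : R) - c) / 2).
  by rewrite divr_gt0// subr_gt0.
move=> t /(_ i); rewrite ler_distl => /andP[+ _] /=.
by move: ca; lra.
Qed.

Lemma cube_open_lt (i : 'I_d) (c : R) :
  cube_open [set t : euclidean R d | (tnth t i : R) < c].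
Proof.
move=> a /= ca; exists ((c - (tnth a i : R)) / 2).
  by rewrite divr_gt0// subr_gt0.
move=> t /(_ i); rewrite ler_distl => /andP[_ +] /=.
by move: ca; lra.
Qed.

Variable nu : {measure set (euclidean R d) -> \bar R}.
Hypothesis nu_fin : (nu setT < +oo)%E.

(** Outer regularity alone is not visibly stable under complement; with the
    closed inner set it becomes so, and a sigma-algebra induction applies. *)
Definition sandwiched A := forall e : R, 0 < e -> exists O F,
  [/\ cube_open O, cube_open (~` F), measurable O & measurable F] /\
  [/\ F `<=` A, A `<=` O & (nu (O `\` F) <= e%:E)%E].

Lemma nu_fin_sub A : measurable A -> (nu A < +oo)%E.
Proof.
by move=> mA; apply: le_lt_trans nu_fin; apply: le_measure; rewrite ?inE.
Qed.

(** Continuity from above, in the form in which it truncates an infinite union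
    of closed sets to a finite one at a small cost in measure. *)
Lemma nonincreasing_measure_le (D : (set (euclidean R d))^nat) (e : \bar R) :
  (forall k, measurable (D k)) -> {homo D : n m / (n <= m)%N >-> (m <= n)%O} ->
  (nu (\bigcap_k D k) < e)%E -> exists m, (nu (D m) <= e)%E.
Proof.
move=> mD hD De; apply: contrapT => /forallNP noD.
have mcap : measurable (\bigcap_k D k) by exact: bigcapT_measurable.
have cvD := nonincreasing_cvg_mu (nu_fin_sub (mD 0%N)) mD mcap hD.
have : (e <= nu (\bigcap_k D k))%E.
  rewrite -(cvg_lim _ cvD)//; apply: lime_ge.
    by apply/cvg_ex; eexists; exact: cvD.
  by near=> n; rewrite ltW// ltNge; apply/negP/noD.
by rewrite leNgt De.
Unshelve. all: by end_near. Qed.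

Lemma sandwiched_setC A : sandwiched A -> sandwiched (~` A).
Proof.
move=> sA e e0; have [ O [F [ [ oO oF mO mF] [FA AO OF]]]] := sA e e0.
exists (~` F), (~` O); split.
  by split; rewrite ?setCK//; exact: measurableC.
split; [exact: subsetC|exact: subsetC|].
by rewrite setDE setCK setIC -setDE.
Qed.

(** The errors [e / 2 / 2 ^ (k + 1)] of the single sets add up to [e / 2]. The
    other half of [e] pays for keeping finitely many of the inner sets, whose
    union, unlike the infinite one, is always closed. *)
Lemma sandwiched_bigcup (A : (set (euclidean R d))^nat) :
  (forall k, sandwiched (A k)) -> sandwiched (\bigcup_k A k).
Proof.
move=> sA e e0.
have e20 : 0 < e / 2 by rewrite divr_gt0.
pose u k : R := e / 2 / (2 ^ k.+1)%:R.
have u0 k : 0 < u k by rewrite divr_gt0// ltr0n expn_gt0.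
have /choice[OF OFP] : forall k,
    exists p : set (euclidean R d) * set (euclidean R d),
    [/\ cube_open p.1, cube_open (~` p.2), measurable p.1 & measurable p.2] /\
  [/\ p.2 `<=` A k, A k `<=` p.1 & (nu (p.1 `\` p.2) <= (u k)%:E)%E].
  by move=> k; have [ O [F OFP]] := sA k _ (u0 k); exists (O, F).
pose O := \bigcup_k (OF k).1.
have mO : measurable O by apply: bigcup_measurable => k _; case: (OFP k) => -[].
pose F m := \bigcup_(k < m) (OF k).2.
have mF m : measurable (F m).
  by apply: bigcup_measurable => k _; case: (OFP k) => -[].
have [m OFm] : exists m, (nu (O `\` F m) <= e%:E)%E.
  apply: nonincreasing_measure_le.
  - by move=> k; exact: measurableD.
  - move=> n m nm; apply/subsetPset; apply: setDS => t [k /= kn Fk].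
    by exists k => //=; exact: leq_trans nm.
  - apply: (@le_lt_trans _ _ (e / 2)%:E); last by rewrite lte_fin; lra.
    apply: (@le_trans _ _ (\sum_(0 <= k <oo) nu ((OF k).1 `\` (OF k).2))%E).
      apply: measure_sigma_subadditive => [k||t].
      + by case: (OFP k) => -[_ _ ? ?] _; exact: measurableD.
      + by apply: bigcapT_measurable => k; exact: measurableD.
      + move=> tF; have [[k _ Ok] _] := tF 0%N I.
        exists k => //; split => // Fk.
        by have [_] := tF k.+1 I; apply; exists k => /=.
    apply: (le_trans _ (epsilon_trick0 xpredT (ltW e20))).
    by apply: lee_nneseries => // k _; case: (OFP k) => _ [].
exists O, (F m); split; split => //.
- by apply: cube_open_bigcup => k; case: (OFP k) => -[].
- rewrite setC_bigcup; apply: cube_open_finbigcap => k.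
  by case: (OFP k) => -[].
- move=> t [k /= _ Fk]; exists k => //.
  by case: (OFP k) => _ [+ _ _]; exact.
- move=> t [k _ Ak]; exists k => //.
  by case: (OFP k) => _ [_ + _]; exact.
Qed.

Lemma sandwiched_set0 : sandwiched set0.
Proof.
move=> e e0; exists set0, set0; split; split => //.
- by rewrite setC0; exact: cube_openT.
- by rewrite setD0 measure0 lee_fin ltW.
Qed.

Lemma measurable_preimage_tnth (i : 'I_d) (B : set (measurableTypeR R)) :
  measurable B -> measurable [set t : euclidean R d | B (tnth t i)].
Proof.
by move=> mB; rewrite -[X in measurable X]setTI; exact: measurable_tnth.
Qed.

(** An open half-space is the increasing union of the closed half-spaces
    starting at [c + 1 / (k + 1)]. *)
Lemma sandwiched_halfspace (i : 'I_d) (c : R) :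
  sandwiched [set t : euclidean R d | c < tnth t i].
Proof.
move=> e e0.
pose O := [set t : euclidean R d | c < tnth t i].
pose F k := [set t : euclidean R d | c + k.+1%:R^-1 <= (tnth t i : R)].
have mO : measurable O.
  rewrite (_ : O = [set t : euclidean R d |
      (`]c, +oo[%classic : set (measurableTypeR R)) (tnth t i)]).
    by apply: measurable_preimage_tnth; exact: measurable_itv.
  by apply/seteqP; split => t /=; rewrite in_itv/= andbT.
have mF k : measurable (F k).
  rewrite (_ : F k = [set t : euclidean R d |
      (`[c + k.+1%:R^-1, +oo[%classic : set (measurableTypeR R)) (tnth t i)]).
    by apply: measurable_preimage_tnth; exact: measurable_itv.
  by apply/seteqP; split => t /=; rewrite in_itv/= andbT.
have [m OFm] : exists m, (nu (O `\` F m) <= e%:E)%E.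
  apply: nonincreasing_measure_le.
  - by move=> k; exact: measurableD.
  - move=> n m nm; apply/subsetPset; apply: setDS => t; apply: le_trans.
    by rewrite lerD2l lef_pV2 ?posrE ?ltr0n// ler_nat.
  - rewrite (_ : \bigcap_k _ = set0) ?measure0 ?lte_fin//.
    rewrite -subset0 => t tF.
    have [/= Ot _] := tF 0%N I.
    have [k /ltW ck] := @ltr_add_invr R _ _ Ot.
    by have [_ /(_ ck)] := tF k I.
exists O, (F m); split; split => //.
- exact: cube_open_gt.
- rewrite (_ : ~` F m =
      [set t : euclidean R d | (tnth t i : R) < c + m.+1%:R^-1]).
    exact: cube_open_lt.
  by apply/seteqP; split => t /=; rewrite ltNge => /negP.
- move=> t; apply: lt_le_trans.
  by rewrite ltrDl invr_gt0.
Qed.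

(** Regularity: the sandwiched sets form a sigma-algebra, and the half-spaces
    it contains generate the product Borel sets, by one sigma-algebra
    induction on the tuples and one on each coordinate. *)
Lemma measurable_sandwiched A : measurable A -> sandwiched A.
Proof.
apply: smallest_sub => /=.
  split; [exact: sandwiched_set0| |exact: sandwiched_bigcup].
  by move=> B sB; rewrite setTD; exact: sandwiched_setC.
elim/big_ind : _ => //.
  by move=> X Y XS YS Z [/XS|/YS].
move=> i _ _ [B mB <-]; rewrite setTI.
pose G := [set B : set (measurableTypeR R) |
  sandwiched ((@tnth d _ ^~ i) @^-1` B)].
suff : @measurable _ (measurableTypeR R) `<=` G by apply.
change (@measurable _ (measurableTypeR R)) with (@ocitv R).-sigma.-measurable.
rewrite measurable_realfun.RGenOInfty.measurableE.
apply: smallest_sub => /=.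
  split.
  - by rewrite /G/= preimage_set0; exact: sandwiched_set0.
  - by move=> X; rewrite /G/= setTD preimage_setC; exact: sandwiched_setC.
  - by move=> X GX; rewrite /G/= preimage_bigcup; exact: sandwiched_bigcup.
move=> _ [c ->]; rewrite /G /=.
rewrite (_ : _ @^-1` _ = [set t : euclidean R d | c < tnth t i]).
  exact: sandwiched_halfspace.
by apply/seteqP; split => t /=; rewrite in_itv/= andbT.
Qed.

End regularity.

(** * Vitali covering by cubes *)

Section vitali.
Context (R : realType) (d : nat).

(** Greedy selection: going through the indices by decreasing radius, keep a
    cube when it is disjoint from those already kept. A discarded cube meets
    a kept one of at least its own radius, whose triple therefore contains
    it. *)
Lemma vitali_cubes (x : nat -> euclidean R d) (r : nat -> R) (s : seq nat) :
  (forall i, 0 <= r i) ->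
  exists D : seq nat, [/\ {subset D <= s},
    trivIset [set` D] (fun i => cube (x i) (r i)) &
    forall i, i \in s -> exists2 j, j \in D &
      cube (x i) (r i) `<=` cube (x j) (3 * r j)].
Proof.
move=> r0.
pose LE i j := r i <= r j.
have LEtrans : transitive LE by move=> i j k; exact: le_trans.
have [t ts LEt] : exists2 t : seq nat, t =i s & sorted LE t.
  exists (sort LE s); first exact: mem_sort.
  by apply: sort_sorted => i j; exact: le_total.
suff [D [Dt tD cD]] : exists D : seq nat, [/\ {subset D <= t},
    trivIset [set` D] (fun i => cube (x i) (r i)) &
    forall i, i \in t -> exists2 j, j \in D &
      cube (x i) (r i) `<=` cube (x j) (3 * r j)].
  exists D; split => //; first by move=> i /Dt; rewrite ts.
  by move=> i; rewrite -ts; exact: cD.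
(* The head has the least radius, so it is the last one to be considered. *)
elim: t {s ts} LEt => [_|i t IH LEt].
  by exists [::]; split => //; move=> i j.
have [D [Dt tD cD]] := IH (path_sorted LEt).
have ri j : j \in t -> r i <= r j.
  by move=> jt; move/(order_path_min LEtrans)/allP : LEt; exact.
have [[j jD [p [ip jp]]]|disj] :=
    pselect (exists2 j, j \in D & cube (x i) (r i) `&` cube (x j) (r j) !=set0).
  exists D; split => //; first by move=> k /Dt kt; rewrite inE kt orbT.
  move=> k; rewrite inE => /predU1P[->|]; last exact: cD.
  exists j => //.
  have rij := ri _ (Dt _ jD).
  apply: subset_trans (cube_sub_cubeD (cube_sym ip)) _.
  apply: subset_trans (cube_sub_cubeD jp) _.
  by apply: subset_cube; lra.
exists (i :: D); split.
- move=> k; rewrite !inE => /predU1P[->|/Dt ->]; first by rewrite eqxx.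
  by rewrite orbT.
- move=> j k /=; rewrite !inE => /predU1P[->|jD] /predU1P[->|kD] // meet.
  + by exfalso; apply: disj; exists k.
  + by exfalso; apply: disj; exists j => //; rewrite setIC.
  + exact: tD.
- move=> k; rewrite inE => /predU1P[->|/cD[j jD kj]].
    exists i; first by rewrite mem_head.
    by apply: subset_cube; rewrite ler_peMl// ler1n.
  by exists j => //; rewrite inE jD orbT.
Qed.

(** For the disjoint cubes selected by [vitali_cubes], tripling the radius
    instead of multiplying it by [k] changes the measure by the factor
    [(3 / k) ^+ d], and the small cubes are still disjoint, inside [B]. *)
Lemma measure_bigcup_cube_le (x : nat -> euclidean R d) (r : nat -> R)
    (k : R) (s : seq nat) (B : set (euclidean R d)) :
  0 < k <= 1 -> (forall i, 0 <= r i) -> measurable B ->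
  (forall i, i \in s -> cube (x i) (k * r i) `<=` B) ->
  (lebesgue_measure_dim R d (\bigcup_(i in [set` s]) cube (x i) (r i)) <=
   ((3 / k) ^+ d)%:E * lebesgue_measure_dim R d B)%E.
Proof.
move=> /andP[k0 k1] r0 mB sB.
set mu := lebesgue_measure_dim R d.
have [D [Ds tD cD]] := @vitali_cubes x r s r0.
have kr0 i : 0 <= k * r i by rewrite mulr_ge0// ltW.
have fD : finite_set [set` D] by exact: finite_seq.
apply: (@le_trans _ _ (\sum_(j \in [set` D]) mu (cube (x j) (3 * r j)))%E).
  apply: content_sub_fsum => //.
  - by move=> i _; exact: measurable_cube.
  - by apply: fin_bigcup_measurable => // i _; exact: measurable_cube.
  - by move=> t [i /= /cD[j jD ij] it]; exists j => //; exact: ij.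
have -> : (\sum_(j \in [set` D]) mu (cube (x j) (3 * r j)) =
    ((3 / k) ^+ d)%:E * \sum_(j \in [set` D]) mu (cube (x j) (k * r j)))%E.
  rewrite ge0_mule_fsumr//; apply: eq_fsbigr => j _.
  rewrite /mu !lebesgue_measure_cube// ?mulr_ge0// -EFinM -exprMn.
  by congr ((_ ^+ d)%:E); field; rewrite gt_eqF.
rewrite lee_pmul2l ?lte_fin ?exprn_gt0 ?divr_gt0//.
rewrite -measure_fin_bigcup//.
- apply: le_measure; rewrite ?inE//.
    by apply: fin_bigcup_measurable => // i _; exact: measurable_cube.
  by move=> t [j /= /Ds js]; exact: sB.
- move=> i j iD jD [t [it jt]]; apply: tD => //; exists t.
  by split; [move: it|move: jt]; apply: subset_cube; rewrite ler_piMl.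
- by move=> i _; exact: measurable_cube.
Qed.

End vitali.

(** * Sets avoiding shrunken cubes *)

Section shrinking.
Context (R : realType) (d : nat).
Let mu := lebesgue_measure_dim R d.

(** Almost every point of the set [C] in question lies in arbitrarily small
    cubes, each with a fixed proportion outside [C]: almost no point of [C]
    is a density point. *)
Lemma negligible_avoid_cubes (x : nat -> euclidean R d) (r : nat -> R)
    (k : R) (n : nat) :
  0 < k <= 1 -> (forall i, 0 <= r i) ->
  mu.-negligible (~` [set a | forall e, 0 < e ->
    exists i, [/\ (n <= i)%N, r i <= e & cube (x i) (r i) a]]) ->
  mu.-negligible (~` \bigcup_(i in [set i | (n <= i)%N]) cube (x i) (k * r i)).
Proof.
move=> k01 r0 [N [mN N0 subN]].
set C := ~` _.
have mC : measurable C.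
  apply: measurableC; apply: bigcup_measurable => i _; exact: measurable_cube.
pose o : euclidean R d := [tuple of nseq d (0 : R)].
have oE i : tnth o i = 0 by rewrite (tnth_nth 0) nth_nseq if_same.
suff CQ0 M : mu.-negligible (C `&` cube o M%:R).
  apply: negligibleS (negligible_bigcup CQ0) => t Ct.
  exists (Num.Def.archi_bound (\sum_i `|tnth t i : R|)) => //; split => // i.
  rewrite oE subr0; apply/ltW.
  apply: le_lt_trans (archi_boundP _); last by apply: sumr_ge0.
  by rewrite (bigD1 i)//= lerDl; apply: sumr_ge0.
have M0 : 0 <= M%:R :> R by [].
set Q := cube o M%:R; pose Q' := cube o (1 + M%:R).
have mQ : measurable Q by exact: measurable_cube.
have mQ' : measurable Q' by exact: measurable_cube.
have mCQ : measurable (C `&` Q) by exact: measurableI.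
pose K := (3 / k) ^+ d.
have K0 : 0 < K by rewrite exprn_gt0// divr_gt0//; case/andP: k01.
apply/negligibleP => //; apply/eqP; rewrite -measure_le0.
apply/lee_addgt0Pr => _/posnumP[e]; rewrite add0e.
have eK0 : 0 < e%:num / K by rewrite divr_gt0.
(* [Q'] leaves room around [Q] for the cubes of radius at most 1/2 that meet
   [Q], and makes the measure finite, as regularity demands. *)
have nuT : (mrestr mu mQ' setT < +oo)%E.
  by rewrite /mrestr setTI /mu lebesgue_measure_cube ?ltry// addr_ge0.
have [U [F [ [oU _ mU mF] [FCQ CQU UF]]]] :=
  measurable_sandwiched nuT mCQ eK0.
pose J := [set i | (n <= i)%N /\ cube (x i) (r i) `<=` U `&` Q'].
pose s m := [seq i <- iota 0 m | i \in J].
have sE m i : (i \in s m) = (i \in J) && (i < m)%N.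
  by rewrite mem_filter mem_iota.
pose W m := \bigcup_(i in [set` s m]) cube (x i) (r i).
have mW m : measurable (W m).
  by apply: fin_bigcup_measurable => // i _; exact: measurable_cube.
have mcW : measurable (\bigcup_m W m) by exact: bigcup_measurable.
have cover : C `&` Q `<=` N `|` \bigcup_m W m.
  move=> a CQa; have [aN|aN] := pselect (N a); [by left|right].
  have /(_ _ _)/= small : forall e0, 0 < e0 ->
      exists i, [/\ (n <= i)%N, r i <= e0 & cube (x i) (r i) a].
    by apply: contrapT => /subN.
  have [u u0 uU] := oU a (CQU _ CQa).
  have [|i [ni ru ia]] := small (Num.min u 1 / 2).
    by rewrite divr_gt0// lt_min u0 ltr01.
  have iau : cube (x i) (r i) `<=` cube a (Num.min u 1).
    apply: subset_trans (cube_sub_cubeD (cube_sym ia)) _.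
    by apply: subset_cube; lra.
  exists i.+1 => //; exists i => //.
  rewrite /= sE ltnS leqnn andbT; apply/mem_set.
  split => // t /iau ta; split.
    by apply/uU/subset_cube/ta; rewrite ge_min lexx.
  apply: (cube_sub_cubeD CQa.2); apply: subset_cube ta.
  by rewrite ge_min lexx orbT.
have WU m : (mu (W m) <= e%:num%:E)%E.
  (* The small cubes lie in [B] because they avoid [C]. *)
  pose B := (U `&` Q') `\` (C `&` Q).
  have mB : measurable B by apply: measurableD => //; exact: measurableI.
  apply: (@le_trans _ _ (K%:E * mu B)%E).
    apply: measure_bigcup_cube_le => // i.
    rewrite sE => /andP[/set_mem[ni iU] _] t it; split.
      apply: iU; apply: subset_cube it.
      by case/andP: k01 => _ k1; rewrite ler_piMl.
    by move=> [+ _]; apply; exists i.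
  rewrite muleC -lee_pdivlMr// -EFinM; apply: le_trans UF.
  rewrite /mrestr; apply: le_measure; rewrite ?inE//.
    by apply: measurableI => //; exact: measurableD.
  by move=> t [[Ut Q't] nCQ]; split => //; split => // /FCQ.
apply: (@le_trans _ _ (mu N + mu (\bigcup_m W m))%E).
  apply: le_trans (measureU2 _ _ _) => //.
  by apply: le_measure; rewrite ?inE//; exact: measurableU.
rewrite N0 add0e.
have hW : {homo W : n m / (n <= m)%N >-> (n <= m)%O}.
  move=> m p mp; apply/subsetPset => t [i /= + it].
  rewrite sE => /andP[Ji im]; exists i => //=.
  by rewrite sE Ji (leq_trans im).
have cvW := nondecreasing_cvg_mu (mu := mu) mW mcW hW.
rewrite -(cvg_lim _ cvW)//; apply: lime_le.
  by apply/cvg_ex; eexists; exact: cvW.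
by near=> m; exact: WU.
Unshelve. all: by end_near. Qed.

(** Only finitely many of the balls that contain [a] have radius larger than
    [e], as all of them meet the unit ball around [a]. *)
Lemma lim_sup_set_small_cubes (x : nat -> euclidean R d) (r : nat -> R)
    (n : nat) (a : euclidean R d) :
  shrinking_locally x r ->
  lim_sup_set (fun i => euclidean_closed_ball (x i) (r i)) a ->
  forall e, 0 < e ->
    exists i, [/\ (n <= i)%N, r i <= e & cube (x i) (r i) a].
Proof.
move=> shr supa e e0.
have /finite_seqP[s sE] := shr a 1 ltr01 e e0.
have [i /= mi ia] := supa (maxn n (\max_(i <- s) i).+1) I.
move: mi; rewrite geq_max => /andP[ni si].
exists i; split => //; last exact: closed_ball_sub_cube.
rewrite leNgt; apply/negP => ei.
have : i \in s.
  suff : [set` s] i by [].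
  rewrite -sE; split => //; exists a; split => //.
  rewrite /euclidean_closed_ball /euclidean_dist /= big1 ?sqrtr0//.
  by move=> j _; rewrite subrr expr0n.
by move/(@leq_bigmax_seq _ s xpredT (fun j => j))/(_ isT); rewrite leqNgt si.
Qed.

End shrinking.

Theorem corollary1p2 (R : realType) (d : nat) (hd : (1 <= d)%N)
    (x : nat -> euclidean R d) (r : nat -> R) (hr : forall i, 0 < r i)
    (hshrink : shrinking_locally x r) :
  {ae lebesgue_measure_dim R d, forall a,
      lim_sup_set (fun i => euclidean_closed_ball (x i) (r i)) a}
  <->
  (forall k : R, 0 < k ->
    {ae lebesgue_measure_dim R d, forall a,
        lim_sup_set (fun i => euclidean_closed_ball (x i) (k * r i)) a}).
Proof.
split => [full k k0|/(_ 1 ltr01)]; last first.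
  by under eq_fun do rewrite mul1r.
(* Dividing by [d] fits a cube into the ball; capping [k] at 1 keeps the small
   cube inside the original one. *)
pose k' := Num.min k 1 / d%:R.
have d0 : 0 < d%:R :> R by rewrite ltr0n.
have m0 : 0 < Num.min k 1 by rewrite lt_min k0 ltr01.
have k'01 : 0 < k' <= 1.
  rewrite divr_gt0//= ler_pdivrMr// mul1r.
  by rewrite (@le_trans _ _ 1) ?ge_min ?lexx ?orbT// ler1n.
have r0 i : 0 <= r i by exact/ltW.
have avoid n : (lebesgue_measure_dim R d).-negligible
    (~` \bigcup_(i in [set i | (n <= i)%N]) cube (x i) (k' * r i)).
  apply: negligible_avoid_cubes => //.
  apply: negligibleS full => a; apply: contra_not => /= supa.
  exact: lim_sup_set_small_cubes.
apply: negligibleS (negligible_bigcup avoid) => a /= nsup.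
apply: contrapT => nC; apply: nsup => n _.
have [i /= ni ia] :
    (\bigcup_(i in [set i | (n <= i)%N]) cube (x i) (k' * r i)) a.
  by apply: contrapT => na; apply: nC; exists n.
exists i => //.
have : euclidean_closed_ball (x i) (Num.min k 1 * r i) a.
  apply: cube_sub_closed_ball => //; first by rewrite mulr_ge0// ltW.
  by rewrite mulrAC.
rewrite /euclidean_closed_ball /= => /le_trans; apply.
by rewrite ler_wpM2r// ge_min lexx.
Qed.
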